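(* The sequent calculus $\mathsf{BDFNL}$ is a conservative extension of $\mathbf{S}_{\mathbb{BDI}}$; that is, for every $\mathcal{L}_{\mathrm{SI}}$-sequent $\phi\vdash\psi$, $\phi\vdash\psi$ is derivable in $\mathbf{S}_{\mathbb{BDI}}$ if and only if it is derivable in $\mathsf{BDFNL}$.
   Context: $\mathcal{L}_{\mathrm{SI}}$-formulas are built from propositional variables and $\top,\bot$ using $\wedge,\vee,\to$. $\mathcal{L}_{\mathrm{LC}}$-formulas are built from propositional variables and $\top,\bot$ using $\wedge,\vee,\to,\bullet,\leftarrow$. A sequent is an expression $\phi\vdash\psi$ with $\phi,\psi$ formulas. $\mathbf{S}_{\mathbb{BDI}}$ has the following axioms and rules for $\mathcal{L}_{\mathrm{SI}}$-formulas. Axioms: $\phi\vdash\phi$; $\phi\wedge(\psi\vee\gamma)\vdash(\phi\wedge\psi)\vee(\phi\wedge\gamma)$; $\phi\vdash\top$; $\bot\vdash\phi$; $\top\vdash\phi\to\top$; $\top\vdash\bot\to\phi$; $(\phi\to\psi)\wedge(\phi\to\gamma)\vdash\phi\to(\psi\wedge\gamma)$; $(\phi\to\gamma)\wedge(\psi\to\gamma)\vdash(\phi\vee\psi)\to\gamma$. Rules: from $\phi\vdash\psi$ infer $\chi\to\phi\vdash\chi\to\psi$; from $\phi\vdash\psi$ infer $\psi\to\chi\vdash\phi\to\chi$; from $\phi_i\vdash\psi$ infer $\phi_1\wedge\phi_2\vdash\psi$ ($i=1,2$); from $\gamma\vdash\phi$ and $\gamma\vdash\psi$ infer $\gamma\vdash\phi\wedge\psi$;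 from $\phi\vdash\chi$ and $\psi\vdash\chi$ infer $\phi\vee\psi\vdash\chi$; from $\psi\vdash\phi_i$ infer $\psi\vdash\phi_1\vee\phi_2$ ($i=1,2$); from $\phi\vdash\psi$ and $\psi\vdash\gamma$ infer $\phi\vdash\gamma$. $\mathsf{BDFNL}$ has the following axioms and rules for $\mathcal{L}_{\mathrm{LC}}$-formulas. Axioms: $\phi\vdash\phi$; $\phi\vdash\top$; $\bot\vdash\phi$; $\phi\wedge(\psi\vee\gamma)\vdash(\phi\wedge\psi)\vee(\phi\wedge\gamma)$. Rules: the same four rule schemes for $\wedge$ and $\vee$ and the cut rule as in $\mathbf{S}_{\mathbb{BDI}}$, together with the residuation rules: $\phi\bullet\psi\vdash\gamma$ and $\psi\vdash\phi\to\gamma$ can be inferred from each other; $\phi\bullet\psi\vdash\gamma$ and $\phi\vdash\gamma\leftarrow\psi$ can be inferred from each other. *)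

(* Defs.v *)
Set Implicit Arguments.
Unset Strict Implicit.

Reserved Notation "A ∧ B" (at level 50, left associativity).
Reserved Notation "A ∨ B" (at level 52, left associativity).
Reserved Notation "A • B" (at level 48, left associativity).
Reserved Notation "A ← B" (at level 54, left associativity).
Reserved Notation "A → B" (at level 56, right associativity).
Reserved Notation "A ⊢SI B" (at level 70, no associativity).
Reserved Notation "A ⊢LC B" (at level 70, no associativity).

(* Propositional variables range over an arbitrary type [V].  The two languages
   are separate types, so that a derivation in S_BDI involves L_SI-formulas
   only; [si_to_lc] below is the inclusion of L_SI in L_LC. *)

Inductive si_formula (V : Type) : Type :=
| si_var : V -> si_formula V
| si_top : si_formula V
| si_bot : si_formula V
| si_and : si_formula V -> si_formula V -> si_formula V
| si_or  : si_formula V -> si_formula V -> si_formula V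
| si_imp : si_formula V -> si_formula V -> si_formula V.

Arguments si_top {V}.
Arguments si_bot {V}.

Declare Scope si_scope.
Delimit Scope si_scope with SI.
Bind Scope si_scope with si_formula.
Notation "⊤" := si_top : si_scope.
Notation "⊥" := si_bot : si_scope.
Notation "A ∧ B" := (si_and A B) : si_scope.
Notation "A ∨ B" := (si_or A B) : si_scope.
Notation "A → B" := (si_imp A B) : si_scope.

Inductive lc_formula (V : Type) : Type :=
| lc_var : V -> lc_formula V
| lc_top : lc_formula V
| lc_bot : lc_formula V
| lc_and : lc_formula V -> lc_formula V -> lc_formula V
| lc_or  : lc_formula V -> lc_formula V -> lc_formula V
| lc_imp : lc_formula V -> lc_formula V -> lc_formula V
| lc_fus : lc_formula V -> lc_formula V -> lc_formula V
| lc_pmi : lc_formula V -> lc_formula V -> lc_formula V.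

Arguments lc_top {V}.
Arguments lc_bot {V}.

Declare Scope lc_scope.
Delimit Scope lc_scope with LC.
Bind Scope lc_scope with lc_formula.
Notation "⊤" := lc_top : lc_scope.
Notation "⊥" := lc_bot : lc_scope.
Notation "A ∧ B" := (lc_and A B) : lc_scope.
Notation "A ∨ B" := (lc_or A B) : lc_scope.
Notation "A → B" := (lc_imp A B) : lc_scope.
Notation "A • B" := (lc_fus A B) : lc_scope.
Notation "A ← B" := (lc_pmi A B) : lc_scope.

(* [S_BDI φ ψ]: the sequent φ ⊢ ψ is derivable in S_BDI; likewise for
   [BDFNL] below. *)

Inductive S_BDI (V : Type) : si_formula V -> si_formula V -> Prop :=
| bdi_id φ : φ ⊢SI φ
| bdi_distr φ ψ γ : φ ∧ (ψ ∨ γ) ⊢SI (φ ∧ ψ) ∨ (φ ∧ γ)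
| bdi_top φ : φ ⊢SI ⊤
| bdi_bot φ : ⊥ ⊢SI φ
| bdi_imp_top φ : ⊤ ⊢SI φ → ⊤
| bdi_bot_imp φ : ⊤ ⊢SI ⊥ → φ
| bdi_imp_and φ ψ γ : (φ → ψ) ∧ (φ → γ) ⊢SI φ → (ψ ∧ γ)
| bdi_or_imp φ ψ γ : (φ → γ) ∧ (ψ → γ) ⊢SI (φ ∨ ψ) → γ
| bdi_imp_mono φ ψ χ : φ ⊢SI ψ -> χ → φ ⊢SI χ → ψ
| bdi_imp_anti φ ψ χ : φ ⊢SI ψ -> ψ → χ ⊢SI φ → χ
| bdi_and_l1 φ1 φ2 ψ : φ1 ⊢SI ψ -> φ1 ∧ φ2 ⊢SI ψ
| bdi_and_l2 φ1 φ2 ψ : φ2 ⊢SI ψ -> φ1 ∧ φ2 ⊢SI ψ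
| bdi_and_r φ ψ γ : γ ⊢SI φ -> γ ⊢SI ψ -> γ ⊢SI φ ∧ ψ
| bdi_or_l φ ψ χ : φ ⊢SI χ -> ψ ⊢SI χ -> φ ∨ ψ ⊢SI χ
| bdi_or_r1 φ1 φ2 ψ : ψ ⊢SI φ1 -> ψ ⊢SI φ1 ∨ φ2
| bdi_or_r2 φ1 φ2 ψ : ψ ⊢SI φ2 -> ψ ⊢SI φ1 ∨ φ2
| bdi_cut φ ψ γ : φ ⊢SI ψ -> ψ ⊢SI γ -> φ ⊢SI γ
where "A ⊢SI B" := (S_BDI A%SI B%SI).

Inductive BDFNL (V : Type) : lc_formula V -> lc_formula V -> Prop :=
| fnl_id φ : φ ⊢LC φ
| fnl_top φ : φ ⊢LC ⊤
| fnl_bot φ : ⊥ ⊢LC φ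
| fnl_distr φ ψ γ : φ ∧ (ψ ∨ γ) ⊢LC (φ ∧ ψ) ∨ (φ ∧ γ)
| fnl_and_l1 φ1 φ2 ψ : φ1 ⊢LC ψ -> φ1 ∧ φ2 ⊢LC ψ
| fnl_and_l2 φ1 φ2 ψ : φ2 ⊢LC ψ -> φ1 ∧ φ2 ⊢LC ψ
| fnl_and_r φ ψ γ : γ ⊢LC φ -> γ ⊢LC ψ -> γ ⊢LC φ ∧ ψ
| fnl_or_l φ ψ χ : φ ⊢LC χ -> ψ ⊢LC χ -> φ ∨ ψ ⊢LC χ
| fnl_or_r1 φ1 φ2 ψ : ψ ⊢LC φ1 -> ψ ⊢LC φ1 ∨ φ2
| fnl_or_r2 φ1 φ2 ψ : ψ ⊢LC φ2 -> ψ ⊢LC φ1 ∨ φ2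
| fnl_cut φ ψ γ : φ ⊢LC ψ -> ψ ⊢LC γ -> φ ⊢LC γ
| fnl_fus_imp φ ψ γ : φ • ψ ⊢LC γ -> ψ ⊢LC φ → γ
| fnl_imp_fus φ ψ γ : ψ ⊢LC φ → γ -> φ • ψ ⊢LC γ
| fnl_fus_pmi φ ψ γ : φ • ψ ⊢LC γ -> φ ⊢LC γ ← ψ
| fnl_pmi_fus φ ψ γ : φ ⊢LC γ ← ψ -> φ • ψ ⊢LC γ
where "A ⊢LC B" := (BDFNL A%LC B%LC).

Fixpoint si_to_lc (V : Type) (A : si_formula V) : lc_formula V :=
  match A with
  | si_var p => lc_var p
  | si_top => lc_top
  | si_bot => lc_bot
  | si_and B C => lc_and (si_to_lc B) (si_to_lc C)
  | si_or B C => lc_or (si_to_lc B) (si_to_lc C)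
  | si_imp B C => lc_imp (si_to_lc B) (si_to_lc C)
  end.

(* Main.v *)
Require Import Defs.

(** Soundness of [S_BDI] in [BDFNL] is a direct derivation: residuation makes
    the implication monotone in its second and antitone in its first argument,
    and turns its distribution laws into properties of the fusion.

    For conservativity, [BDFNL] is interpreted in a residuated distributive
    lattice built from the Lindenbaum algebra of [S_BDI].  Call a set of
    [L_SI]-formulas closed under derivability and finite conjunctions a filter.
    Two filters have a product
      [G ⊙ F = {c | a → c ∈ F for some a ∈ G}],
    which is again a filter because the implication preserves finite meets in
    its second argument.  The truth values are the filters of filters: the
    families of filters that are closed under larger filters and finite
    intersections.  Under inclusion they form a distributive lattice, because
    the filters of a distributive lattice do.

    The product preserves finite intersections in each argument
    ([fprod_meet_l], [fprod_meet_r], [fprod_full_l], [fprod_full_r]); in the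
    first argument this rests on the laws
    [(φ → γ) ∧ (ψ → γ) ⊢ (φ ∨ ψ) → γ] and [⊤ ⊢ ⊥ → φ].
    Consequently both residuals of the product, computed on families of
    filters, are truth values, and so [BDFNL] is sound ([soundness]).

    Every [L_SI]-formula [φ] takes as value the family of filters containing
    [φ] ([truth_lemma]); for an implication [φ → ψ] and a filter [F], the
    product of [F] with the principal filter of [φ] contains [ψ] only if [F]
    contains [φ → ψ].  Applying soundness to the principal filter of [φ] then
    shows that a sequent [φ ⊢ ψ] derivable in [BDFNL] is derivable in [S_BDI].
    Since truth values are families of arbitrary filters, rather than of prime
    ones, no choice principle and no excluded middle is involved. *)

Set Implicit Arguments.
Unset Strict Implicit.

(** * The implication laws of the smaller calculus by residuation *)

Section Embedding.

Variable V : Type.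
Implicit Types A B C : lc_formula V.

Lemma fnl_modus_ponens A C : BDFNL (lc_fus A (lc_imp A C)) C.
Proof. apply fnl_imp_fus, fnl_id. Qed.

Lemma fnl_fus_mono_r A B C :
  BDFNL B C -> BDFNL (lc_fus A B) (lc_fus A C).
Proof.
  intros H. apply fnl_imp_fus. apply (fnl_cut H).
  apply fnl_fus_imp, fnl_id.
Qed.

Lemma fnl_fus_mono_l A B C :
  BDFNL A B -> BDFNL (lc_fus A C) (lc_fus B C).
Proof.
  intros H. apply fnl_pmi_fus. apply (fnl_cut H).
  apply fnl_fus_pmi, fnl_id.
Qed.

Lemma S_BDI_sound_BDFNL (φ ψ : si_formula V) :
  S_BDI φ ψ -> BDFNL (si_to_lc φ) (si_to_lc ψ).
Proof.
  intros H; induction H; simpl.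
  - apply fnl_id.
  - apply fnl_distr.
  - apply fnl_top.
  - apply fnl_bot.
  - apply fnl_fus_imp, fnl_top.
  - apply fnl_fus_imp, fnl_pmi_fus, fnl_bot.
  - apply fnl_fus_imp, fnl_and_r;
      (eapply fnl_cut; [apply fnl_fus_mono_r | apply fnl_modus_ponens]).
    + apply fnl_and_l1, fnl_id.
    + apply fnl_and_l2, fnl_id.
  - apply fnl_fus_imp, fnl_pmi_fus, fnl_or_l; apply fnl_fus_pmi;
      (eapply fnl_cut; [apply fnl_fus_mono_r | apply fnl_modus_ponens]).
    + apply fnl_and_l1, fnl_id.
    + apply fnl_and_l2, fnl_id.
  - apply fnl_fus_imp.
    eapply fnl_cut; [apply fnl_modus_ponens | exact IHS_BDI].
  - apply fnl_fus_imp.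
    eapply fnl_cut; [apply fnl_fus_mono_l, IHS_BDI | apply fnl_modus_ponens].
  - apply fnl_and_l1; assumption.
  - apply fnl_and_l2; assumption.
  - apply fnl_and_r; assumption.
  - apply fnl_or_l; assumption.
  - apply fnl_or_r1; assumption.
  - apply fnl_or_r2; assumption.
  - eapply fnl_cut; eassumption.
Qed.

End Embedding.

(** * Filters of formulas *)

Section Filters.

Variable V : Type.
Implicit Types a b c d : si_formula V.

(** A set of formulas closed under derivability and finite conjunctions, that
    is, a lattice filter of the Lindenbaum algebra of [S_BDI].  The set of all
    formulas is included. *)
Record filter : Type := Filter {
  mem :> si_formula V -> Prop;
  mem_top : mem si_top;
  mem_up : forall a b, S_BDI a b -> mem a -> mem b;
  mem_and : forall a b, mem a -> mem b -> mem (si_and a b)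
}.

Implicit Types F G H : filter.

Definition fsub F G : Prop := forall a, F a -> G a.

Lemma bdi_and_mono a b c d :
  S_BDI a c -> S_BDI b d -> S_BDI (si_and a b) (si_and c d).
Proof.
  intros; apply bdi_and_r; [apply bdi_and_l1 | apply bdi_and_l2]; assumption.
Qed.

Definition full : filter.
Proof. exists (fun _ => True); auto. Defined.

(** The principal filter of [a]. *)
Definition principal a : filter.
Proof.
  exists (fun b => S_BDI a b).
  - apply bdi_top.
  - intros b c Hbc Hab; exact (bdi_cut Hab Hbc).
  - intros b c; apply bdi_and_r.
Defined.

Definition fmeet F G : filter.
Proof.
  exists (fun a => F a /\ G a).
  - split; apply mem_top.
  - intros a b Hab [HF HG]; split; eapply mem_up; eassumption.
  - intros a b [] []; split; apply mem_and; assumption.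
Defined.

(** The filter generated by the union of two filters. *)
Definition fjoin F G : filter.
Proof.
  exists (fun c => exists a b, F a /\ G b /\ S_BDI (si_and a b) c).
  - exists si_top, si_top.
    split; [|split]; [apply mem_top | apply mem_top | apply bdi_top].
  - intros c d Hcd (a & b & Ha & Hb & Hab).
    exists a, b; split; [|split]; auto. exact (bdi_cut Hab Hcd).
  - intros c c' (a & b & Ha & Hb & Hc) (a' & b' & Ha' & Hb' & Hc').
    exists (si_and a a'), (si_and b b').
    split; [|split]; try (apply mem_and; assumption).
    apply bdi_and_r.
    + refine (bdi_cut _ Hc). apply bdi_and_mono; apply bdi_and_l1, bdi_id.
    + refine (bdi_cut _ Hc'). apply bdi_and_mono; apply bdi_and_l2, bdi_id.
Defined.

(** The product [G ⊙ F] of filters, the least filter [H] such that [a ∈ G] and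
    [a → c ∈ F] imply [c ∈ H].  The antecedents come from the left factor, in
    accordance with [φ • (φ → γ) ⊢ γ]. *)
Definition fprod G F : filter.
Proof.
  exists (fun c => exists a, G a /\ F (si_imp a c)).
  - exists si_top; split; [apply mem_top|].
    exact (mem_up (bdi_imp_top _) (mem_top F)).
  - intros c d Hcd (a & Ha & HF); exists a; split; auto.
    exact (mem_up (bdi_imp_mono _ Hcd) HF).
  - intros c c' (a & Ha & HF) (a' & Ha' & HF').
    exists (si_and a a'); split; [apply mem_and; assumption|].
    apply (mem_up (bdi_imp_and _ _ _)), mem_and.
    + refine (mem_up (bdi_imp_anti _ _) HF); apply bdi_and_l1, bdi_id.
    + refine (mem_up (bdi_imp_anti _ _) HF'); apply bdi_and_l2, bdi_id.
Defined.

Lemma fprod_mono G G' F F' :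
  fsub G G' -> fsub F F' -> fsub (fprod G F) (fprod G' F').
Proof. intros HG HF c (a & Ha & Hc); exists a; auto. Qed.

Lemma fprod_full_r G : fsub full (fprod G full).
Proof. intros c _; exists si_top; split; [apply mem_top | exact I]. Qed.

Lemma fprod_full_l F : fsub full (fprod full F).
Proof.
  intros c _; exists si_bot; split; [exact I|].
  exact (mem_up (bdi_bot_imp _) (mem_top F)).
Qed.

Lemma fprod_meet_r G F F' :
  fsub (fmeet (fprod G F) (fprod G F')) (fprod G (fmeet F F')).
Proof.
  intros c [(a & Ha & HF) (a' & Ha' & HF')].
  exists (si_and a a'); split; [apply mem_and; assumption|split].
  - refine (mem_up (bdi_imp_anti _ _) HF); apply bdi_and_l1, bdi_id.
  - refine (mem_up (bdi_imp_anti _ _) HF'); apply bdi_and_l2, bdi_id.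
Qed.

Lemma fprod_meet_l G G' F :
  fsub (fmeet (fprod G F) (fprod G' F)) (fprod (fmeet G G') F).
Proof.
  intros c [(a & Ha & HF) (a' & Ha' & HF')].
  exists (si_or a a'); split; [split|].
  - exact (mem_up (bdi_or_r1 _ (bdi_id _)) Ha).
  - exact (mem_up (bdi_or_r2 _ (bdi_id _)) Ha').
  - apply (mem_up (bdi_or_imp _ _ _)), mem_and; assumption.
Qed.

(** Distributivity of the lattice of filters, in the case where [F] contains
    the intersection of [G] and [H]. *)
Lemma fjoin_distr F G H :
  fsub (fmeet G H) F -> fsub (fmeet (fjoin F G) (fjoin F H)) F.
Proof.
  intros HGH c [(f & g & Hf & Hg & Hc) (f' & h & Hf' & Hh & Hc')].
  assert (Hgh : F (si_or g h)).
  { apply HGH; split.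
    - exact (mem_up (bdi_or_r1 _ (bdi_id _)) Hg).
    - exact (mem_up (bdi_or_r2 _ (bdi_id _)) Hh). }
  refine (mem_up _ (mem_and (mem_and Hf Hf') Hgh)).
  apply (bdi_cut (bdi_distr _ _ _)), bdi_or_l.
  - refine (bdi_cut _ Hc). apply bdi_and_mono; [apply bdi_and_l1|]; apply bdi_id.
  - refine (bdi_cut _ Hc'). apply bdi_and_mono; [apply bdi_and_l2|]; apply bdi_id.
Qed.

Lemma fsub_fjoin_l F G : fsub F (fjoin F G).
Proof.
  intros a Ha; exists a, si_top; split; [|split]; auto using mem_top.
  apply bdi_and_l1, bdi_id.
Qed.

Lemma fsub_fjoin_r F G : fsub G (fjoin F G).
Proof.
  intros a Ha; exists si_top, a; split; [|split]; auto using mem_top.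
  apply bdi_and_l2, bdi_id.
Qed.

(** * Truth values *)

(** The families of filters that serve as truth values: filters of the lattice
    of filters ordered by inclusion.  The empty intersection is the filter of
    all formulas. *)
Record truth_value (X : filter -> Prop) : Prop := TruthValue {
  tv_full : X full;
  tv_up : forall F G, fsub F G -> X F -> X G;
  tv_meet : forall F G, X F -> X G -> X (fmeet F G)
}.

Definition tv_join (X Y : filter -> Prop) (F : filter) : Prop :=
  exists G H, X G /\ Y H /\ fsub (fmeet G H) F.

(** The least truth value containing all products of a member of [X] and a
    member of [Y]. *)
Definition tv_fus (X Y : filter -> Prop) (H : filter) : Prop :=
  forall Z, truth_value Z -> (forall G F, X G -> Y F -> Z (fprod G F)) -> Z H.

Definition tv_imp (X Z : filter -> Prop) (F : filter) : Prop :=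
  forall G, X G -> Z (fprod G F).

Definition tv_pmi (Z Y : filter -> Prop) (G : filter) : Prop :=
  forall F, Y F -> Z (fprod G F).

(** The value of a formula when a variable denotes the family of filters
    containing it. *)
Fixpoint eval (A : lc_formula V) : filter -> Prop :=
  match A with
  | lc_var p => fun F => F (si_var p)
  | lc_top => fun _ => True
  | lc_bot => fun F => forall a, F a
  | lc_and B C => fun F => eval B F /\ eval C F
  | lc_or B C => tv_join (eval B) (eval C)
  | lc_imp B C => tv_imp (eval B) (eval C)
  | lc_fus B C => tv_fus (eval B) (eval C)
  | lc_pmi C B => tv_pmi (eval C) (eval B)
  end.

Lemma tv_join_truth_value X Y :
  truth_value X -> truth_value Y -> truth_value (tv_join X Y).
Proof.
  intros HX HY; split.
  - exists full, full.
    split; [|split]; [apply (tv_full HX) | apply (tv_full HY) | intros a _; exact I].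
  - intros F F' HF (G & H & HG & HH & Hs).
    exists G, H; split; [|split]; auto. intros a Ha; auto.
  - intros F F' (G & H & HG & HH & Hs) (G' & H' & HG' & HH' & Hs').
    exists (fmeet G G'), (fmeet H H'); split; [|split].
    + apply (tv_meet HX); assumption.
    + apply (tv_meet HY); assumption.
    + intros a [[] []]; split; [apply Hs | apply Hs']; split; assumption.
Qed.

Lemma tv_fus_truth_value X Y : truth_value (tv_fus X Y).
Proof.
  split.
  - intros Z HZ _; apply (tv_full HZ).
  - intros F G HFG HF Z HZ HXY. exact (tv_up HZ HFG (HF Z HZ HXY)).
  - intros F G HF HG Z HZ HXY.
    exact (tv_meet HZ (HF Z HZ HXY) (HG Z HZ HXY)).
Qed.

Lemma tv_imp_truth_value X Z : truth_value Z -> truth_value (tv_imp X Z).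
Proof.
  intros HZ; split.
  - intros G _. exact (tv_up HZ (@fprod_full_r G) (tv_full HZ)).
  - intros F F' HF HX G HG. refine (tv_up HZ _ (HX G HG)).
    apply fprod_mono; [intros a Ha; exact Ha | exact HF].
  - intros F F' HF HF' G HG. apply (tv_up HZ (@fprod_meet_r G F F')).
    apply (tv_meet HZ); auto.
Qed.

Lemma tv_pmi_truth_value Z Y : truth_value Z -> truth_value (tv_pmi Z Y).
Proof.
  intros HZ; split.
  - intros F _. exact (tv_up HZ (@fprod_full_l F) (tv_full HZ)).
  - intros G G' HG HX F HF. refine (tv_up HZ _ (HX F HF)).
    apply fprod_mono; [exact HG | intros a Ha; exact Ha].
  - intros G G' HG HG' F HF. apply (tv_up HZ (@fprod_meet_l G G' F)).
    apply (tv_meet HZ); auto.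
Qed.

Lemma eval_truth_value A : truth_value (eval A).
Proof.
  induction A as [p| | |B HB C HC|B HB C HC|B HB C HC|B HB C HC|C HC B HB]; simpl.
  - split; simpl; auto.
  - split; auto.
  - split; simpl; auto.
  - split.
    + split; [apply (tv_full HB) | apply (tv_full HC)].
    + intros F G HFG []; split;
        [apply (tv_up HB HFG) | apply (tv_up HC HFG)]; assumption.
    + intros F G [] []; split;
        [apply (tv_meet HB) | apply (tv_meet HC)]; assumption.
  - apply tv_join_truth_value; assumption.
  - apply tv_imp_truth_value; assumption.
  - apply tv_fus_truth_value.
  - apply tv_pmi_truth_value; assumption.
Qed.

Lemma tv_join_l X Y F : truth_value Y -> X F -> tv_join X Y F.
Proof.
  intros HY HF; exists F, full; split; [|split]; auto.
  - apply (tv_full HY).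
  - intros a []; assumption.
Qed.

Lemma tv_join_r X Y F : truth_value X -> Y F -> tv_join X Y F.
Proof.
  intros HX HF; exists full, F; split; [|split]; auto.
  - apply (tv_full HX).
  - intros a []; assumption.
Qed.

Theorem soundness A B : BDFNL A B -> forall F, eval A F -> eval B F.
Proof.
  intros D; induction D; simpl in *; intros F HF.
  - exact HF.
  - exact I.
  - exact (tv_up (eval_truth_value φ) (fun a _ => HF a)
             (tv_full (eval_truth_value φ))).
  - destruct HF as (HF & G & H & HG & HH & Hs).
    exists (fjoin F G), (fjoin F H); split; [split|split; [split|]].
    + exact (tv_up (eval_truth_value φ) (@fsub_fjoin_l F G) HF).
    + exact (tv_up (eval_truth_value ψ) (@fsub_fjoin_r F G) HG).
    + exact (tv_up (eval_truth_value φ) (@fsub_fjoin_l F H) HF).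
    + exact (tv_up (eval_truth_value γ) (@fsub_fjoin_r F H) HH).
    + apply fjoin_distr; exact Hs.
  - destruct HF; auto.
  - destruct HF; auto.
  - auto.
  - destruct HF as (G & H & HG & HH & Hs).
    apply (tv_up (eval_truth_value χ) Hs).
    apply (tv_meet (eval_truth_value χ)); auto.
  - apply tv_join_l; auto using eval_truth_value.
  - apply tv_join_r; auto using eval_truth_value.
  - auto.
  - intros G HG. apply IHD. intros Z _ HZ; auto.
  - apply HF; [apply eval_truth_value|]. intros G F' HG HF'. exact (IHD F' HF' G HG).
  - intros G HG. apply IHD. intros Z _ HZ; auto.
  - apply HF; [apply eval_truth_value|]. intros G F' HG HF'. exact (IHD G HG F' HF').
Qed.

(** * The truth lemma *)

Lemma truth_lemma a : forall F, eval (si_to_lc a) F <-> F a.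
Proof.
  induction a as [p| | |a IHa b IHb|a IHa b IHb|a IHa b IHb]; simpl; intros F.
  - split; trivial.
  - split; [intros _; apply mem_top | trivial].
  - split; [auto|]. intros HF a; exact (mem_up (bdi_bot a) HF).
  - split.
    + intros [HA HB]; apply mem_and; [apply IHa | apply IHb]; assumption.
    + intros HF; split; [apply IHa | apply IHb]; refine (mem_up _ HF);
        [apply bdi_and_l1 | apply bdi_and_l2]; apply bdi_id.
  - split.
    + intros (G & H & HG & HH & Hs).
      apply IHa in HG. apply IHb in HH. apply Hs; split.
      * exact (mem_up (bdi_or_r1 _ (bdi_id _)) HG).
      * exact (mem_up (bdi_or_r2 _ (bdi_id _)) HH).
    + intros HF; exists (principal a), (principal b); split; [|split].
      * apply IHa, bdi_id.
      * apply IHb, bdi_id.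
      * intros c [Hac Hbc]. exact (mem_up (bdi_or_l Hac Hbc) HF).
  - split.
    + intros HF.
      assert (Hb : fprod (principal a) F b) by (apply IHb, HF, IHa, bdi_id).
      destruct Hb as (c & Hac & Hc). exact (mem_up (bdi_imp_anti _ Hac) Hc).
    + intros HF G HG. apply IHb. exists a; split; [apply IHa|]; assumption.
Qed.

Lemma BDFNL_conservative (φ ψ : si_formula V) :
  BDFNL (si_to_lc φ) (si_to_lc ψ) -> S_BDI φ ψ.
Proof.
  intros D. apply (truth_lemma ψ (principal φ)), (soundness D), truth_lemma.
  apply bdi_id.
Qed.

End Filters.

Theorem corollary1 (V : Type) (φ ψ : si_formula V) :
  S_BDI φ ψ <-> BDFNL (si_to_lc φ) (si_to_lc ψ).
Proof.
  split.
  - apply S_BDI_sound_BDFNL.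
  - apply BDFNL_conservative.
Qed.
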